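(* Let $0 < k < n$ be an integer, $p > 1$, and let $h \geq 0$ and $w \geq 0$ be a pair of functions in $C_b(\mathcal{G}_{n-k,n})$ such that $hw \in C_0(\mathcal{G}_{n-k,n})$, $h \in L^p(\mathcal{G}_{n-k,n},w)$ and $w \in L^1(\mathcal{G}_{n-k,n})$. For any non-negative function $g \in C_0(\mathcal{G}_{n-k,n}) \cap L^p(\mathcal{G}_{n-k,n},w)$ (with $\|g\|_{L^p(\mathcal{G}_{n-k,n},w)}$ and $\|h\|_{L^p(\mathcal{G}_{n-k,n},w)}$ nonzero), the following estimate is valid: \[ \frac{\|g\|_{L^p(\mathcal{G}_{n-k,n},w)}}{\|h\|_{L^p(\mathcal{G}_{n-k,n},w)}} \leq d_{p,w}(g,\mathcal{A}_p^k)^{p-1} \left\|\frac{\mathcal{R}_{n-k}^*[gw]}{\mathcal{R}_{n-k}^*[hw]}\right\|_{L^\infty(\mathbb{R}^n)}. \]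
   Context: $G_{n-k,n}$ is the Grassmannian of $(n-k)$-dimensional linear subspaces of $\mathbb{R}^n$ with Haar measure $\nu_{n-k}$ of total mass $|S^{k-1}||S^{n-k-1}|/|S^{n-1}|$. $\mathcal{G}_{n-k,n}$ is the manifold of $(n-k)$-dimensional affine subspaces of $\mathbb{R}^n$; its elements are written $(H,z)$, with $H\in G_{n-k,n}$, $z\in H^\perp$, representing $H+z$. $C_b$ denotes bounded continuous real functions, $C_0$ continuous real functions vanishing at infinity. For $w\ge0$, $\|g\|_{L^p(\mathcal{G}_{n-k,n},w)}=\left(\int_{G_{n-k,n}}\int_{H^\perp}|g(H,z)|^p\,w(H,z)\,dz\,d\nu_{n-k}(H)\right)^{1/p}$, and $L^p(\mathcal{G}_{n-k,n})$ corresponds to $w\equiv1$. The dual $(n-k)$-dimensional Radon transform is $\mathcal{R}_{n-k}^*\psi(x)=\int_{G_{n-k,n}}\psi(H,P_{H^\perp}(x))\,d\nu_{n-k}(H)$, $x\in\mathbb{R}^n$, with $P_{H^\perp}$ the orthogonal projection onto $H^\perp$. For a finite Radon measure $\mu$ on $\mathbb{R}^n$, $\mathcal{R}_{n-k}\mu$ is the measure on $\mathcal{G}_{n-k,n}$ with $\langle\mathcal{R}_{n-k}\mu,\psi\rangle_k=\int_{\mathbb{R}^n}\mathcal{R}_{n-k}^*\psi\,d\mu$ for all $\psi\in C_0(\mathcal{G}_{n-k,n})$; a function $u$ on $\mathcal{G}_{n-k,n}$ is identified with the functional $\psi\mapsto\int_{G_{n-k,n}}\int_{H^\perp}u\,\psi\,dz\,d\nu_{n-k}(H)$,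 and $u=\mathcal{R}_{n-k}\mu$ is understood in this sense. The class of $(p,k)$-admissible functions is $$\mathcal{A}_p^{k}=\{f\in C_0(\mathcal{G}_{n-k,n}): f\ge 0,\ f^{p-1}=\mathcal{R}_{n-k}\mu\text{ for some }\mu\in\mathcal{M}^+(\mathbb{R}^n)\},$$ where $\mathcal{M}^+(\mathbb{R}^n)$ is the set of non-negative Radon measures of finite total variation. For non-negative $g\in C_0(\mathcal{G}_{n-k,n})\cap L^p(\mathcal{G}_{n-k,n},w)$ with nonzero norm, $$d_{p,w}(g,\mathcal{A}_p^k)=\inf\left\{\frac{\|f\|_{L^p(\mathcal{G}_{n-k,n},w)}}{\|g\|_{L^p(\mathcal{G}_{n-k,n},w)}}: f\ge g,\ f\in\mathcal{A}_p^k\cap L^p(\mathcal{G}_{n-k,n},w)\right\},$$ with $\inf\emptyset=+\infty$. Convention for the quotient of dual transforms: $0/0:=0$ and $a/0:=+\infty$ for $a>0$. *)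

(* Defs.v *)
From HB Require Import structures.
From mathcomp Require Import all_boot all_order all_algebra.
From mathcomp Require Import zify.
From mathcomp Require Import all_classical all_reals all_analysis.
From mathcomp Require Import measurable_realfun.

Set Implicit Arguments.
Unset Strict Implicit.
Unset Printing Implicit Defensive.
Import Order.TTheory GRing.Theory Num.Theory.
Import numFieldNormedType.Exports.
Local Open Scope classical_set_scope.
Local Open Scope ring_scope.

Section Euclidean.
Context {R : realType} {n : nat}.
Implicit Types (x y : 'rV[R]_n) (V : {vspace 'rV[R]_n}).

Definition dotp x y : R := (x *m y^T) 0 0.

(* the common kernel of the scalar products with a basis of V; see memv_orthov *)
Definition orthov V : {vspace 'rV[R]_n} :=
  lker (linfun (mulmxr (\matrix_(i < \dim V) (vbasis V)`_i)^T)).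

Definition oproj V : 'End('rV[R]_n) := daddv_pi V (orthov V).

Lemma dotpC x y : dotp x y = dotp y x.
Proof. by rewrite /dotp -{1}(trmxK x) -trmx_mul mxE. Qed.

Lemma dotpE x y : dotp x y = \sum_i x 0 i * y 0 i.
Proof. by rewrite /dotp mxE; apply: eq_bigr => i _; rewrite mxE. Qed.

Lemma dotp_eq0 x : (dotp x x == 0) = (x == 0).
Proof.
apply/eqP/eqP => [|->]; last by rewrite /dotp mul0mx mxE.
rewrite dotpE => /psumr_eq0P => /(_ (fun i _ => sqr_ge0 (x 0 i))) x0.
by apply/rowP => i; rewrite mxE; apply/eqP; rewrite -sqrf_eq0 expr2 x0.
Qed.

Lemma memv_orthov V x :
  reflect (forall y, y \in V -> dotp x y = 0) (x \in orthov V).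
Proof.
rewrite memv_ker lfunE /=; apply: (iffP eqP) => [x0 y|x0].
  move=> /coord_vbasis ->; rewrite /dotp linear_sum /= mulmx_sumr summxE big1// => i _.
  rewrite linearZ /= -scalemxAr mxE.
  have /rowP/(_ i) := x0; rewrite [in RHS]mxE => xi.
  suff -> : (x *m ((vbasis V)`_i)^T) 0 0 = 0 by rewrite mulr0.
  by rewrite -[RHS]xi !mxE; apply: eq_bigr => j _; rewrite !mxE.
apply/rowP => i; rewrite [RHS]mxE -[RHS](x0 ((vbasis V)`_i)); last first.
  by rewrite vbasis_mem ?mem_nth ?size_tuple.
by rewrite /dotp !mxE; apply: eq_bigr => j _; rewrite !mxE.
Qed.

Lemma capv_orthov V : (V :&: orthov V = 0)%VS.
Proof.
apply/eqP; rewrite -subv0; apply/subvP => x; rewrite memv_cap memv0 -dotp_eq0.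
by move=> /andP[xV /memv_orthov/(_ _ xV) ->].
Qed.

Lemma dimv_orthov V : \dim (orthov V) = (n - \dim V)%N.
Proof.
have dimf : \dim (fullv : {vspace 'rV[R]_n}) = n.
  by rewrite dimvf /dim /= mul1n.
have := dimv_sum_cap V (orthov V); rewrite capv_orthov dimv0 addn0 => dS.
have := dimvS (subvf (V + orthov V)%VS); rewrite dimf dS => le1.
set f : 'Hom('rV[R]_n, 'rV[R]_(\dim V)) :=
  linfun (mulmxr (\matrix_(i < \dim V) (vbasis V)`_i)^T).
have := limg_ker_dim f fullv; rewrite capfv dimf -/(orthov V).
have := dimvS (subvf (f @: fullv)%VS); rewrite [X in (_ <= X)%N]dimvf /dim /= mul1n.
rewrite {2}/orthov -/f => le2 eq; apply/eqP; rewrite eqn_leq leq_subRL; last first.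
  by apply: leq_trans le1; exact: leq_addr.
rewrite le1/= leq_subLR -[X in (X <= _)%N]eq addnC leq_add//.
Qed.

Lemma addv_orthov V : (V + orthov V = fullv)%VS.
Proof.
have dimf : \dim (fullv : {vspace 'rV[R]_n}) = n.
  by rewrite dimvf /dim /= mul1n.
apply/eqP; rewrite eqEdim subvf/=.
have := dimv_sum_cap V (orthov V); rewrite capv_orthov dimv0 addn0 => ->.
by rewrite dimv_orthov dimf subnKC// -[X in (_ <= X)%N]dimf dimvS// subvf.
Qed.

Lemma oproj_mem V x : oproj V x \in V.
Proof. exact: memv_pi. Qed.

Lemma oproj_sub_orth V x : x - oproj V x \in orthov V.
Proof.
have xV : x \in (V + orthov V)%VS by rewrite addv_orthov memvf.
rewrite -{1}(daddv_pi_add (capv_orthov V) xV) addrC addKr; exact: memv_pi.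
Qed.

Lemma ex_onb V : exists Q : 'M[R]_(\dim V, n),
  Q *m Q^T = 1%:M /\ forall i, row i Q \in V.
Proof.
move: {-2}(\dim V) (erefl (\dim V)) => d.
elim: d V => [|d IHd] V dV.
  by exists 0; split=> [|[]//]; apply/matrixP => -[].
have V0 : (V != 0)%VS by rewrite -dimv_eq0 -dV.
have [u uV u0] : exists2 u, u \in V & u != 0.
  by exists (vpick V); rewrite ?memv_pick ?vpick0.
have uu : 0 < dotp u u.
  by rewrite lt_neqAle eq_sym dotp_eq0 u0 dotpE sumr_ge0// => i _; exact: sqr_ge0.
pose e := (Num.sqrt (dotp u u))^-1 *: u.
have eV : e \in V by rewrite memvZ.
have ee : e *m e^T = 1%:M.
  apply/matrixP => i j; rewrite !ord1 [RHS]mxE eqxx.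
  rewrite linearZ/= -scalemxAr -scalemxAl mxE [X in _ * X]mxE -/(dotp u u).
  rewrite mulrA -expr2 exprVn sqr_sqrtr ?ltW// mulVf// gt_eqF//.
pose W := (V :&: orthov <[e]>)%VS.
have dW : d = \dim W.
  have := dimv_sum_cap V (orthov <[e]>).
  have e0 : e != 0.
    by apply: contra_eq_neq ee => ->; rewrite mul0mx -scalemx1 scale1r eq_sym oner_neq0.
  have -> : (V + orthov <[e]> = fullv)%VS.
    apply/eqP; rewrite eqEsubv subvf/= -(addv_orthov <[e]>) addvS//.
  have dimf : \dim (fullv : {vspace 'rV[R]_n}) = n by rewrite dimvf /dim /= mul1n.
  rewrite dimf dimv_orthov dim_vline e0 -dV -/W.
  have := dimvS (subvf V); rewrite dimf -dV.
  by clear; move=> ? ?; lia.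
have [Q [QQ QW]] := IHd W dW.
have eW i : e *m (row i Q)^T = 0.
  have := QW i; rewrite memv_cap => /andP[_ /memv_orthov/(_ e (memv_line e))].
  by rewrite dotpC /dotp => h; apply/matrixP => a b; rewrite !ord1 h mxE.
have eQ : e *m Q^T = 0.
  apply/rowP => i; rewrite [RHS]mxE; have /matrixP/(_ 0 0) := eW i.
  rewrite [RHS]mxE => <-; rewrite !mxE; apply: eq_bigr => j _.
  by rewrite !mxE.
have Qe : Q *m e^T = 0 by rewrite -[LHS]trmxK trmx_mul trmxK eQ trmx0.
have QI : col_mx e Q *m (col_mx e Q)^T = 1%:M.
  by rewrite tr_col_mx mul_col_row ee QQ eQ Qe -scalar_mx_block.
have QV (i : 'I_(1 + d)) : row i (col_mx e Q) \in V.
  rewrite -[i]splitK; case: (fintype.split i) => j /=.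
    by rewrite rowKu ord1 row_id.
  by rewrite rowKd; have := QW j; rewrite memv_cap => /andP[].
by exists (col_mx e Q).
Qed.

End Euclidean.

Definition borel (T : ptopologicalType) := g_sigma_algebraType (@open T).
HB.instance Definition _ (T : ptopologicalType) :=
  Measurable.copy (borel T) (g_sigma_algebraType (@open T)).

Section Lebesgue.
Context {R : realType}.

Definition rcons_row n (vx : borel 'rV[R]_n * measurableTypeR R)
    : borel 'rV[R]_n.+1 :=
  \row_i if unlift ord_max i is Some j then (vx.1 : 'rV[R]_n) 0 j else vx.2.

Lemma measurable_rcons_row n : measurable_fun setT (@rcons_row n).
Proof.
apply: (@measurability _ _ _ _ _ _ (@open 'rV[R]_n.+1 : set (set (borel 'rV[R]_n.+1)))); first by [].
move=> _ [U oU <-]; rewrite setTI.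
pose box (c : 'rV[rat]_n * rat * nat) : set (borel 'rV[R]_n * measurableTypeR R) :=
  (ball (map_mx ratr c.1.1 : 'rV[R]_n) c.2.+1%:R^-1) `*`
  (ball (ratr c.1.2 : R) c.2.+1%:R^-1).
rewrite [X in measurable X](_ : _ = \bigcup_(c in setT)
    if pselect (box c `<=` @rcons_row n @^-1` U) then box c else set0).
  apply: countable_bigcupT_measurable => [|c]; first exact: countableP.
  case: pselect => [?|?] /=; last by [].
  apply: measurableX; last first.
    exact: measurable_ball.
  by apply: sub_sigma_algebra; exact: ball_open.
apply/seteqP; split => [[v x]/= Uvx|t [c _]]; last by case: pselect => [sub|?] /=; [exact: sub|by []].
have /nbhs_ballP[e /= e0 eU] : nbhs (rcons_row (v, x)) U by exact: open_nbhs_nbhs.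
have [N Ne] : exists N : nat, N.+1%:R^-1 < e / 2.
  by exists (Num.truncn (e / 2)^-1); rewrite invf_plt ?posrE ?divr_gt0// truncnS_gt.
have N0 : 0 < N.+1%:R^-1 :> R by rewrite invr_gt0.
have rat_near (y : R) : exists q : rat, ball (ratr q : R) N.+1%:R^-1 y.
  have [r [yr [q _ qr]]] : ball y N.+1%:R^-1 `&` range ratr !=set0.
    by apply: dense_rat; [exists y; exact: ballxx|exact: ball_open].
  by exists q; rewrite qr; exact: ball_sym.
have [q qx] := rat_near x.
have /choice[Q Qv] : forall j, exists q : rat, ball (ratr q : R) N.+1%:R^-1 ((v : 'rV[R]_n) 0 j).
  by move=> j; exact: rat_near.
have bvx : box (\row_j Q j, q, N) (v, x).
  by split=> //=; split=> // i j; rewrite !mxE ord1.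
exists (\row_j Q j, q, N) => //; case: pselect => [//|[]].
move=> [v' x'] [/= [_ bv'] bx']; apply: eU; split => // i j; rewrite ord1 !mxE.
case: unliftP => [l _|_] /=.
  apply: (@le_ball _ _ _ (N.+1%:R^-1 + N.+1%:R^-1)); first by rewrite [leRHS]splitr lerD// ltW.
  apply: (@ball_triangle _ (R : pseudoMetricType R) (ratr (Q l) : R)); first exact/ball_sym/Qv.
  by have := bv' 0 l; rewrite !mxE.
apply: (@le_ball _ _ _ (N.+1%:R^-1 + N.+1%:R^-1)); first by rewrite [leRHS]splitr lerD// ltW.
by apply: (@ball_triangle _ (R : pseudoMetricType R) (ratr q : R)) => //; exact/ball_sym.
Qed.

Section leb_step.
Context n (mu : {measure set (borel 'rV[R]_n) -> \bar R}).

Definition leb_step : set (borel 'rV[R]_n.+1) -> \bar R :=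
  pushforward (mu \x @lebesgue_measure R)%E (@rcons_row n).

Let leb_step0 : leb_step set0 = 0%E.
Proof. by rewrite /leb_step /pushforward preimage_set0 measure0. Qed.

Let leb_step_ge0 A : (0 <= leb_step A)%E.
Proof. by rewrite /leb_step /pushforward measure_ge0. Qed.

Let leb_step_sigma_additive : semi_sigma_additive leb_step.
Proof. by apply: measure_semi_sigma_additive; exact: measurable_rcons_row. Qed.

HB.instance Definition _ := isMeasure.Build _ _ _ leb_step
  leb_step0 leb_step_ge0 leb_step_sigma_additive.

End leb_step.

(* the product of n copies of the Lebesgue measure of R *)
Fixpoint leb n : {measure set (borel 'rV[R]_n) -> \bar R} :=
  if n is m.+1 then leb_step (leb m) else \d_((0 : 'rV[R]_0) : borel 'rV[R]_0).

End Lebesgue.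

Section SubspaceIntegral.
Context {R : realType} {n : nat}.
Implicit Type V : {vspace 'rV[R]_n}.

Definition onb V : 'M[R]_(\dim V, n) :=
  get [set Q | Q *m Q^T = 1%:M /\ forall i, row i Q \in V].

Lemma onbP V : onb V *m (onb V)^T = 1%:M /\ forall i, row i (onb V) \in V.
Proof. exact: (getPex (ex_onb V)). Qed.

(* integral for the Lebesgue measure of V, in the orthonormal coordinates
   y |-> y *m onb V *)
Definition vs_integral V (F : 'rV[R]_n -> \bar R) : \bar R :=
  (\int[leb (\dim V)]_y F ((y : 'rV[R]_(\dim V)) *m onb V)%R)%E.

(* |S^(m-1)| = m |B^m|, that is 2 pi^(m/2) / Gamma(m/2), for m > 0 *)
Definition sphere_area (m : nat) : R :=
  m%:R * fine (leb m [set x : 'rV[R]_m | dotp x x <= 1]).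

End SubspaceIntegral.

Section Grassmannian.
Variables (R : realType) (n k : nat).

Definition grass := {H : {vspace 'rV[R]_n} | \dim H == (n - k)%N}.

Lemma dimv_take_vbasis :
  \dim <<take (n - k) (vbasis (fullv : {vspace 'rV[R]_n}))>>%VS == (n - k)%N.
Proof.
have := basis_free (vbasisP (fullv : {vspace 'rV[R]_n})).
rewrite -{1}(cat_take_drop (n - k) (vbasis fullv)) => /catl_free.
rewrite /free => /eqP ->; rewrite size_takel // size_tuple dimvf /dim /= mul1n.
exact: leq_subr.
Qed.

Definition grass0 : grass :=
  exist (fun H : {vspace 'rV[R]_n} => \dim H == (n - k)%N) _ dimv_take_vbasis.

(* the topology of G_{n-k,n} is that of the orthogonal projections onto its
   elements *)
Definition grass_proj (H : grass) : 'M[R]_n := lin1_mx (oproj (val H)).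

HB.instance Definition _ := Choice.on grass.
HB.instance Definition _ := isPointed.Build grass grass0.
HB.instance Definition _ := Topological.copy grass (initial_topology grass_proj).

Definition agrass :=
  {Hz : grass * 'rV[R]_n | Hz.2 \in orthov (val Hz.1)}.

HB.instance Definition _ := Choice.on agrass.
HB.instance Definition _ := Topological.copy agrass
  (initial_topology (val : agrass -> grass * 'rV[R]_n)).

Definition Pperp (H : grass) : 'rV[R]_n -> 'rV[R]_n := oproj (orthov (val H)).

Lemma Pperp_mem H x : Pperp H x \in orthov (val H).
Proof. exact: oproj_mem. Qed.

(* the affine subspace H + x, that is (H, Pperp H x); it is (H, x) when x is
   orthogonal to H *)
Definition aff (H : grass) (x : 'rV[R]_n) : agrass :=
  exist (fun Hz : grass * 'rV[R]_n => Hz.2 \in orthov (val Hz.1))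
    (H, Pperp H x) (Pperp_mem H x).

Lemma aff_orth H x : x \in orthov (val H) -> val (aff H x) = (H, x).
Proof. by move=> xH; rewrite /= /Pperp /oproj daddv_pi_id ?capv_orthov. Qed.

End Grassmannian.
Arguments grass : clear implicits.
Arguments agrass : clear implicits.

Section FunctionSpaces.
Context {R : realType} {T : topologicalType}.

Definition Cb : set (T -> R) :=
  [set f | continuous f /\ exists M : R, forall x, `|f x| <= M].

Definition C0 : set (T -> R) :=
  [set f | continuous f /\ forall e : R, 0 < e ->
    exists2 K : set T, compact K & forall x, ~ K x -> `|f x| < e].

End FunctionSpaces.

Section Radon.
Context {R : realType} {n k : nat}.
Local Notation G := (borel (grass R n k)).
Local Notation AG := (agrass R n k).
Implicit Types (nu : {measure set G -> \bar R}) (f g w psi : AG -> R).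

Definition rotate (U : 'M[R]_n) (A : set G) : set G :=
  [set H : grass R n k | exists2 H' : grass R n k,
    A H' & val H = (linfun (mulmxr U) @: val H')%VS].

(* The normalized O(n)-invariant Borel measure on G_{n-k,n}: these two
   conditions determine nu. *)
Definition is_haar nu :=
  (forall (U : 'M[R]_n) (A : set G), U *m U^T = 1%:M -> measurable A ->
     nu (rotate U A) = nu A) /\
  nu setT = (sphere_area k * sphere_area (n - k) / sphere_area n)%:E.

Definition ag_integral nu (F : AG -> \bar R) : \bar R :=
  (\int[nu]_H vs_integral (orthov (val (H : grass R n k)))
    (fun z => F (aff H z)))%E.

Definition Lpnorm nu w (p : R) g : \bar R :=
  (ag_integral nu (fun Hz => (`|g Hz| `^ p * w Hz)%:E) `^ p^-1)%E.

(* used on continuous functions only, hence no measurability clause *)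
Definition in_Lp nu w p g := (Lpnorm nu w p g < +oo)%E.

Definition dual_radon nu psi (x : 'rV[R]_n) : R :=
  \int[nu]_H psi (aff H x).

(* u = R_{n-k} mu: the functional psi |-> <u, psi> is the measure R_{n-k} mu.
   Finite Borel measures on R^n are the finite Radon measures. *)
Definition is_radon nu (mu : {finite_measure set (borel 'rV[R]_n) -> \bar R}) u :=
  forall psi, C0 psi ->
    ag_integral nu (fun Hz => (u Hz * psi Hz)%:E) =
    (\int[mu]_x (dual_radon nu psi x)%:E)%E.

Definition admissible nu p : set (AG -> R) :=
  [set f | [/\ C0 f, forall Hz, 0 <= f Hz &
    exists mu, is_radon nu mu (fun Hz => f Hz `^ (p - 1))]].

Definition dist_admissible nu p w g : \bar R :=
  ereal_inf [set (Lpnorm nu w p f / Lpnorm nu w p g)%E | f in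
    [set f | [/\ admissible nu p f, in_Lp nu w p f & forall Hz, g Hz <= f Hz]]].

Definition quot (a b : R) : \bar R :=
  if b != 0 then (a / b)%:E else if a == 0 then 0%E else +oo%E.

End Radon.

(* Main.v *)
(** Let [f >= g] be admissible with [f ^ (p - 1) = R mu], and let [M] be the
    essential supremum of [R* [g w] / R* [h w]].  Dual transforms of [C0] functions
    are continuous, so [R* [g w] <= M R* [h w]] everywhere, and
    [||g|| ^ p <= <f ^ (p - 1), g w> = int R* [g w] d mu <= M int R* [h w] d mu
     = M <f ^ (p - 1), h w> <= M ||h|| ||f|| ^ (p - 1)] by Hoelder's inequality;
    take the infimum over [f].  The value [M = 0] is excluded, since then
    [R* [g w]] vanishes on a countable dense set, so that [g w = 0] on almost every
    fibre; for [M = +oo] it suffices that the distance is at least [1]. *)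
Require Import Defs.
From mathcomp Require Import all_boot all_order all_algebra.
From mathcomp Require Import all_classical all_reals all_analysis.
From mathcomp Require Import measurable_realfun ess_sup_inf.
From mathcomp Require Import ring.
Set Implicit Arguments.
Unset Strict Implicit.
Unset Printing Implicit Defensive.
Import Order.TTheory GRing.Theory Num.Theory.
Import numFieldNormedType.Exports.
Local Open Scope classical_set_scope.
Local Open Scope ring_scope.
(* MathComp's sesquilinear forms also define [orthov]. *)
Local Notation orthov := Defs.orthov.

(** * Integral inequalities for functions not known to be measurable *)

Section NonmeasurableIntegral.
Local Open Scope ereal_scope.
Context {d} {T : measurableType d} {R : realType} (mu : {measure set T -> \bar R}).
Implicit Types F G : T -> \bar R.

(* The integral of a non-negative function is a supremum over simple functions,
   so that monotonicity needs no measurability. *)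
Lemma ge0_le_integral_nomeas F G : (forall x, 0 <= F x) ->
  (forall x, F x <= G x) -> \int[mu]_x F x <= \int[mu]_x G x.
Proof.
move=> F0 FG; have G0 x : 0 <= G x by exact: le_trans (FG x).
rewrite !ge0_integralTE//; apply: ge_ereal_sup => _ [h /= hF <-].
by apply: ereal_sup_ubound; exists h => //= x; exact: le_trans (hF x) (FG x).
Qed.

Lemma le_integral_nomeas F G : (forall x, 0 <= G x) ->
  (forall x, F x <= G x) -> \int[mu]_x F x <= \int[mu]_x G x.
Proof.
move=> G0 FG; rewrite integralE.
(* The integral is that of the positive part minus that of the negative part; dropping the latter
   can only increase it. *)
apply: (@le_trans _ _ (\int[mu]_x F^\+ x)).
  by rewrite -[leRHS]adde0 leeD// oppe_le0 integral_ge0.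
by apply: ge0_le_integral_nomeas => // x; rewrite funeposE ge_max FG G0.
Qed.

(** [F] lies below the function equal to [+oo] on [N] and to 0 elsewhere, whose integral is
    [+oo * 0 = 0]. *)
Lemma integral0_nomeas F (N : set T) : measurable N -> mu N = 0 ->
  (forall x, 0 <= F x) -> (forall x, ~ N x -> F x = 0) -> \int[mu]_x F x = 0.
Proof.
move=> mN N0 F0 FN; apply/eqP; rewrite eq_le integral_ge0 ?andbT//.
apply: (@le_trans _ _ (\int[mu]_(x in N) (cst +oo) x)).
  rewrite (integral_mkcond N); apply: ge0_le_integral_nomeas => // x.
  by rewrite patchE; case: ifPn => [_|/negP]; rewrite ?leey// inE => /FN ->.
by rewrite integral_cst// N0 mule0.
Qed.

End NonmeasurableIntegral.

(** * Borel measurability, [C0] functions and sequential continuity *)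

Section Borel.
Context {R : realType}.

Lemma borel_open (T : ptopologicalType) (A : set T) :
  open A -> measurable (A : set (borel T)).
Proof. by move=> oA; exact: sub_sigma_algebra. Qed.

Lemma continuous_borel_measurable (T : ptopologicalType) (f : T -> R) :
  continuous f -> measurable_fun setT (f : borel T -> R).
Proof.
move=> cf; apply: (measurability _ (RGenOpens.measurableE R)) => _ [_ [a [b ->] <-]].
rewrite setTI; apply: borel_open.
by apply: open_comp => [x _|]; [exact: cf|exact: interval_open].
Qed.

Lemma C0_bounded (T : topologicalType) (f : T -> R) : C0 f ->
  exists M : R, forall x, `|f x| <= M.
Proof.
move=> [cf /(_ 1 ltr01)[K cK fK]].
have [|M [Mr HM]] := @compact_bounded _ _ (f @` K).
  by apply: continuous_compact => //; exact: continuous_subspaceT.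
exists (Num.max 1 (`|M| + 1)) => x; rewrite le_max.
have [Kx|/fK/ltW ->//] := pselect (K x).
by rewrite (HM (`|M| + 1))// ?orbT// ltr_pwDr// ler_norm.
Qed.

Lemma C0Mb (T : topologicalType) (f w : T -> R) :
  C0 f -> Cb w -> C0 (fun x => f x * w x).
Proof.
move=> [cf f0] [cw [M wM]]; split=> [x|e e0]; first by apply: cvgM; [exact: cf|exact: cw].
have M1 : 0 < `|M| + 1 by rewrite ltr_pwDr.
have [K cK fK] := f0 (e / (`|M| + 1)) (divr_gt0 e0 M1).
exists K => // x /fK fx; rewrite normrM.
apply: (@le_lt_trans _ _ (`|f x| * (`|M| + 1))).
  rewrite ler_wpM2l// (le_trans (wM x))// (le_trans (ler_norm M))// lerDl//.
by rewrite -ltr_pdivlMr.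
Qed.

Lemma C0_lincomb (T : topologicalType) (f g : T -> R) (a b : R) :
  C0 f -> C0 g -> C0 (fun x => a * f x - b * g x).
Proof.
suff C0Z c (u : T -> R) : C0 u -> C0 (fun x => u x * c).
  move=> /(C0Z a)[cf f0] /(C0Z b)[cg g0]; split=> [x|e e0].
    apply: cvgB; first by under eq_fun do rewrite mulrC; rewrite mulrC; exact: cf.
    by under eq_fun do rewrite mulrC; rewrite mulrC; exact: cg.
  have [K cK fK] := f0 (e / 2) (divr_gt0 e0 (ltr0Sn _ 1)).
  have [L cL gL] := g0 (e / 2) (divr_gt0 e0 (ltr0Sn _ 1)).
  exists (K `|` L); first exact: compactU.
  move=> x /not_orP[/fK fx /gL gx]; rewrite (le_lt_trans (ler_normB _ _))//.
  by rewrite [ltRHS]splitr !(mulrC a) !(mulrC b) ltrD.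
move=> u0; apply: C0Mb => //; split; first exact: cst_continuous.
by exists `|c|.
Qed.

(** Dominated convergence concerns sequences, so continuity of a dual transform is tested along
    them. *)
Lemma seq_continuous n (f : 'rV[R]_n -> R) (x : 'rV[R]_n) :
  (forall u : nat -> 'rV[R]_n, u @ \oo --> x -> f \o u @ \oo --> f x) ->
  {for x, continuous f}.
Proof.
move=> fu A /nbhs_ballP[e /= e0 eA]; apply: contrapT => notnear.
have /choice[u ux] (m : nat) :
    exists y, ball x m.+1%:R^-1 y /\ ~ ball (f x) e (f y).
  apply: contrapT => /forallNP H; apply: notnear.
  apply/nbhs_ballP; exists m.+1%:R^-1 => //=.
  by move=> y xy; apply: eA; have /not_andP[//|/contrapT] := H y.
have : u @ \oo --> x.
  apply/cvg_ballP => r r0; near=> m; apply: le_ball (ux m).1.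
  rewrite -[leRHS]invrK lef_pV2 ?posrE ?invr_gt0//.
  near: m; exists (Num.truncn r^-1) => // s /= rs.
  by apply/ltW; rewrite -truncn_le_nat.
move=> /fu/cvg_ballP/(_ e e0)[N _ /(_ N (leqnn N))] /=.
exact: (ux N).2.
Unshelve. all: by end_near. Qed.

End Borel.

(** * Limits of matrices and limits in initial topologies *)

Section MatrixLimits.
Context {K : realType} {T : Type} {F : set_system T} {FF : Filter F}.

Lemma cvg_mx m n (f : T -> 'M[K]_(m, n)) (a : 'M[K]_(m, n)) :
  (forall i j, f t i j @[t --> F] --> a i j) -> f @ F --> a.
Proof.
move=> fa A [P Pa PA]; apply: (filterS (P := [set t | forall i j, P i j (f t i j)])).
  by move=> t Pt; exact: PA.
apply: filter_forall => i; apply: filter_forall => j; exact: fa (Pa i j).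
Qed.

Lemma cvg_coord m n (f : T -> 'M[K]_(m, n)) (a : 'M[K]_(m, n)) i j :
  f @ F --> a -> f t i j @[t --> F] --> a i j.
Proof. by move=> fa A Aa; exact: (fa _ (@coord_continuous K m n i j a A Aa)). Qed.

Lemma cvg_mulmx m n q (f : T -> 'M[K]_(m, n)) (g : T -> 'M[K]_(n, q))
    (a : 'M[K]_(m, n)) (b : 'M[K]_(n, q)) :
  f @ F --> a -> g @ F --> b -> f t *m g t @[t --> F] --> a *m b.
Proof.
move=> fa gb; apply: cvg_mx => i j; rewrite mxE; under eq_cvg do rewrite mxE.
apply: (cvg_big add_continuous) => l _; apply: cvgM .
  exact: cvg_coord.
exact: cvg_coord.
Qed.

Lemma cvg_mxB m n (f g : T -> 'M[K]_(m, n)) (a b : 'M[K]_(m, n)) :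
  f @ F --> a -> g @ F --> b -> f t - g t @[t --> F] --> a - b.
Proof.
move=> fa gb; apply: cvg_mx => i j; rewrite !mxE; under eq_cvg do rewrite !mxE.
apply: cvgB; first exact: cvg_coord.
exact: cvg_coord.
Qed.

Lemma cvg_initial (S : choiceType) (U : topologicalType) (w : S -> U)
    (f : T -> initial_topology w) (s : initial_topology w) :
  w (f t) @[t --> F] --> w s -> f @ F --> s.
Proof.
move=> fs A [_ [[W oW <-] /= Ws WA]]; apply: (filterS WA).
by apply: fs; exact: open_nbhs_nbhs.
Qed.

End MatrixLimits.

(** * Joint continuity of the affine subspace [H + x] in [H] and [x] *)

Section AffContinuity.
Context {R : realType} {n k : nat}.
Local Notation G := (grass R n k).
Local Notation AG := (agrass R n k).

(** The projection onto [orthov V] fixes [x - oproj V x] and kills [oproj V x], which lies in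
    [orthov (orthov V)]. *)
Lemma oproj_orthov (V : {vspace 'rV[R]_n}) x : oproj (orthov V) x = x - oproj V x.
Proof.
have yV : oproj V x \in orthov (orthov V).
  by apply/memv_orthov => z /memv_orthov/(_ _ (oproj_mem V x)); rewrite dotpC.
rewrite -{1}(subrK (oproj V x) x) [LHS]linearD /oproj.
rewrite [X in X + _]daddv_pi_id ?capv_orthov ?oproj_sub_orth//.
rewrite -[RHS]addr0; congr (_ + _).
have pid : daddv_pi (orthov (orthov V)) (orthov V) (oproj V x) = oproj V x.
  by apply: daddv_pi_id => //; rewrite capvC; exact: capv_orthov.
have := daddv_pi_add (capv_orthov (orthov V)) (memv_add (mem0v _) yV).
rewrite add0r -/(oproj V) pid => /(canRL (addrK _)).
by rewrite subrr.
Qed.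

(** The map [grass_proj] is continuous by the very definition of the topology of the Grassmannian,
    so this formula yields continuity in [H] and [x] together. *)
Lemma PperpE (H : G) x : Pperp H x = x - x *m grass_proj H.
Proof. by rewrite /Pperp oproj_orthov /grass_proj mul_rV_lin1. Qed.

Lemma cvg_aff (T : Type) (F : set_system T) {FF : Filter F}
    (H_ : T -> G) (x_ : T -> 'rV[R]_n) (H : G) (x : 'rV[R]_n) :
  H_ @ F --> H -> x_ @ F --> x -> aff (H_ t) (x_ t) @[t --> F] --> aff H x.
Proof.
move=> HH xx; have PP : Pperp (H_ t) (x_ t) @[t --> F] --> Pperp H x.
  under eq_cvg do rewrite PperpE; rewrite PperpE.
  apply: cvg_mxB => //; apply: cvg_mulmx => // A HA.
  exact: (HH _ (@initial_continuous _ _ (@grass_proj R n k) H A HA)).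
apply: (@cvg_initial _ _ _ _ _ _ (fun t => aff (H_ t) (x_ t))).
exact: (cvg_pair HH PP).
Qed.

End AffContinuity.

(** * Linearity, boundedness and continuity of the dual transform *)

Section DualRadon.
Context {R : realType} {n k : nat}.
Local Notation G := (borel (grass R n k)).
Local Notation AG := (agrass R n k).
Variable nu : {measure set G -> \bar R}.
Hypothesis nu_fin : (nu setT < +oo)%E.
Implicit Types (psi : AG -> R) (x : 'rV[R]_n).

Lemma aff_comp_measurable psi x : continuous psi ->
  measurable_fun setT (fun H : G => psi (aff (H : grass R n k) x)).
Proof.
move=> cpsi; apply: (@continuous_borel_measurable R (grass R n k)) => H.
apply: (@continuous_comp _ _ _ (fun H : grass R n k => aff H x) psi); last exact: cpsi.
by apply: (cvg_aff (F := nbhs H)); [exact: cvg_id|exact: cvg_cst].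
Qed.

Lemma aff_comp_continuous psi (H : grass R n k) : continuous psi ->
  continuous (fun x => psi (aff H x)).
Proof.
move=> cpsi x; apply: (@continuous_comp _ _ _ (aff H) psi); last exact: cpsi.
by apply: (cvg_aff (F := nbhs x)); [exact: cvg_cst|exact: cvg_id].
Qed.

Lemma integrable_aff_comp psi x : C0 psi ->
  nu.-integrable setT (EFin \o (fun H : G => psi (aff (H : grass R n k) x))).
Proof.
move=> psi0; have [M psiM] := C0_bounded psi0.
apply: measurable_bounded_integrable => //.
  by apply: aff_comp_measurable; exact: psi0.1.
by exists M; split; rewrite ?num_real// => m /ltW Mm H _; exact: le_trans (psiM _) Mm.
Qed.

Lemma dual_radon_lincomb psi phi (a b : R) x : C0 psi -> C0 phi ->
  dual_radon nu (fun y => a * psi y - b * phi y) x =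
  a * dual_radon nu psi x - b * dual_radon nu phi x.
Proof.
move=> psi0 phi0; have ipsi := integrable_aff_comp x psi0.
have iphi := integrable_aff_comp x phi0.
rewrite /dual_radon RintegralB ?RintegralZl//.
  exact: (integrableZl measurableT a ipsi).
exact: (integrableZl measurableT b iphi).
Qed.

Lemma dual_radon_ge0 psi x : (forall y, 0 <= psi y) -> 0 <= dual_radon nu psi x.
Proof. by move=> psi0; apply: Rintegral_ge0. Qed.

Lemma dual_radon_bounded psi : C0 psi ->
  exists M : R, forall x, `|dual_radon nu psi x| <= M.
Proof.
move=> psi0; have [M psiM] := C0_bounded psi0; exists (M * fine (nu setT)) => x.
have ipsi := integrable_aff_comp x psi0.
rewrite (le_trans (le_normr_Rintegral _ ipsi))// -Rintegral_cst//.
apply: le_Rintegral => //; first exact: integrable_norm.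
by apply: measurable_bounded_integrable => //; exists `|M|; split=> [|m /ltW Mm ? _].
Qed.

(** Dominated convergence along sequences: a constant bounding [psi] is integrable because [nu] is
    finite. *)
Lemma dual_radon_continuous psi : C0 psi -> continuous (dual_radon nu psi).
Proof.
move=> psi0 x; apply: seq_continuous => u ux; have [M psiM] := C0_bounded psi0.
have iu y : (\int[nu]_H (psi (aff (H : grass R n k) y))%:E)%E \is a fin_num.
  exact: (integrable_fin_num _ (integrable_aff_comp y psi0)).
rewrite /dual_radon; apply: (@fine_cvg _ _ _ _
  (fun m => \int[nu]_H (psi (aff (H : grass R n k) (u m)))%:E)%E).
rewrite fineK//; apply: (@dominated_cvg _ _ _ nu _ measurableT _ _ (cst M%:E)) => //.
- by move=> m; apply/measurable_EFinP; apply: aff_comp_measurable; exact: psi0.1.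
- move=> H _; apply: cvg_EFin; first by near=> m.
  exact: (cvg_comp _ _ ux (@aff_comp_continuous psi H psi0.1 x)).
- by apply: (@measurable_bounded_integrable _ _ _ nu (cst M)) => //;
    exists `|M|; split=> [|m /ltW Mm ? _].
- by move=> m H _; rewrite lee_fin.
Unshelve. all: by end_near. Qed.

Lemma dual_radon_integrable (mu : {finite_measure set (borel 'rV[R]_n) -> \bar R}) psi :
  C0 psi -> mu.-integrable setT (fun x => (dual_radon nu psi x)%:E).
Proof.
move=> psi0; apply: measurable_bounded_integrable => //.
- exact: fin_num_fun_lty.
- apply: (@continuous_borel_measurable R 'rV[R]_n); exact: dual_radon_continuous.
- have [M psiM] := dual_radon_bounded psi0.
  by exists M; split; rewrite ?num_real// => m /ltW Mm y _; exact: le_trans (psiM _) Mm.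
Qed.

End DualRadon.

(** * Positivity of Lebesgue measure on nonempty open sets *)

Section LebPositive.
Context {R : realType}.
Local Open Scope ereal_scope.

(** Balls of ['rV[R]_n] are cubes, so a ball in dimension [n.+1] contains the image of a ball in
    dimension [n] times an interval. The induction starts from the Dirac mass in dimension 0. *)
Lemma leb_ball_gt0 n (c : 'rV[R]_n) (e : R) : (0 < e)%R -> 0 < leb n (ball c e).
Proof.
elim: n c => [|n IHn] c e0 /=.
  rewrite diracE mem_set ?lte_fin//; split=> // i [//].
pose B := ball (\row_j c 0%R (lift ord_max j) : 'rV[R]_n) e.
pose I := ball (c 0%R ord_max : R) e.
have mB : measurable (B : set (borel 'rV[R]_n)) by apply: borel_open; exact: ball_open.
have mI : measurable (I : set (measurableTypeR R)) by exact: measurable_ball.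
have I0 : 0 < @lebesgue_measure R I.
  by rewrite lebesgue_measure_ball ?ltW// lte_fin mulrn_wgt0.
have : 0 < (leb n \x @lebesgue_measure R) (B `*` I).
  rewrite product_measure1E// mule_gt0//; exact: IHn.
move=> /lt_le_trans; apply; rewrite /leb_step/= /pushforward.
apply: le_measure; rewrite ?inE.
- exact: measurableX.
- rewrite -[X in measurable X]setTI; apply: measurable_rcons_row => //.
  by apply: borel_open; exact: ball_open.
- move=> [v t] [/= [_ Bv] It]; split=> // i j; rewrite ord1 mxE.
  by case: unliftP => [l ->|->]//; have := Bv 0%R l; rewrite mxE.
Qed.

Lemma leb_open_gt0 n (U : set 'rV[R]_n) : open U -> U !=set0 -> 0 < leb n U.
Proof.
move=> oU [x Ux]; have /nbhs_ballP[e /= e0 eU] : nbhs x U by exact: open_nbhs_nbhs.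
apply: (lt_le_trans (leb_ball_gt0 x e0)); apply: le_measure; rewrite ?inE//.
  by apply: borel_open; exact: ball_open.
exact: borel_open.
Qed.

(** The complement is open and null, hence empty. An inequality between continuous functions thus
    passes from almost everywhere to everywhere, which is needed to integrate it against a [mu] that
    may be singular. *)
Lemma leb_ae_closed n (C : set 'rV[R]_n) : closed C ->
  {ae leb n, forall x, C x} -> forall x, C x.
Proof.
move=> cC aeC x; apply: contrapT => nCx.
have oC : open (~` C) by exact: closed_openC.
have := leb_open_gt0 oC (ex_intro _ x nCx); rewrite lt_neqAle => /andP[/eqP + _].
apply; apply/esym/measure_negligible => //; exact: borel_open.
Qed.

End LebPositive.

(** * Integrals over the affine Grassmannian and the norms built on them *)

Section AgIntegral.
Context {R : realType} {n k : nat}.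
Local Notation G := (borel (grass R n k)).
Local Notation AG := (agrass R n k).
Variable nu : {measure set G -> \bar R}.
Local Open Scope ereal_scope.
Implicit Types (F : AG -> \bar R).

Lemma ag_integral_ge0 F : (forall y, 0 <= F y) -> 0 <= ag_integral nu F.
Proof. by move=> F0; apply: integral_ge0 => H _; apply: integral_ge0. Qed.

Lemma le_ag_integral F1 F2 : (forall y, 0 <= F2 y) ->
  (forall y, F1 y <= F2 y) -> ag_integral nu F1 <= ag_integral nu F2.
Proof.
move=> F20 F12; apply: le_integral_nomeas => H; first exact: integral_ge0.
by apply: le_integral_nomeas.
Qed.

Lemma eq_ag_integral F1 F2 : F1 =1 F2 -> ag_integral nu F1 = ag_integral nu F2.
Proof. by move=> /funext ->. Qed.

Lemma Lpnorm_poweR w p g : (forall y, (0 <= w y)%R) -> p != 0%R ->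
  Lpnorm nu w p g `^ p = ag_integral nu (fun y => (`|g y| `^ p * w y)%:E).
Proof.
move=> w0 p0; rewrite /Lpnorm -poweRrM mulVf// poweRe1//.
by apply: ag_integral_ge0 => y; rewrite lee_fin mulr_ge0// powR_ge0.
Qed.

Lemma Lpnorm_fin_pos w p g : in_Lp nu w p g -> Lpnorm nu w p g <> 0 ->
  exists2 a : R, (0 < a)%R & Lpnorm nu w p g = a%:E.
Proof.
rewrite /in_Lp; have : 0 <= Lpnorm nu w p g by exact: poweR_ge0.
case: (Lpnorm nu w p g) => // a a0 _ aN0; exists a => //.
by rewrite lt_neqAle -lee_fin a0 andbT eq_sym; apply/eqP => a00; apply: aN0; rewrite a00.
Qed.

Hypothesis nu_fin : nu setT < +oo.

(** At each rational point the non-negative integrand vanishes off a null set of [H]. Countably many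
    null sets have a null union, and continuity in [x] extends the vanishing from rational points to
    all points. *)
Lemma ae_dual_radon0 (psi : AG -> R) : C0 psi -> (forall y, (0 <= psi y)%R) ->
  (forall x, dual_radon nu psi x = 0%R) ->
  {ae nu, forall H : G, forall x, psi (aff (H : grass R n k) x) = 0%R}.
Proof.
move=> psi0 psi_ge0 dpsi0.
have ae_rat (m : nat) : {ae nu, forall H : G, forall q : 'rV[rat]_n,
    unpickle m = Some q -> psi (aff (H : grass R n k) (map_mx ratr q)) = 0%R}.
  case: unpickle => [q|]; last exact: aeW.
  have iq := integrable_aff_comp nu_fin (map_mx ratr q) psi0.
  have /ae_eq_integral_abs : measurable_fun setT (fun H : G =>
      (psi (aff (H : grass R n k) (map_mx ratr q)))%:E).
    exact: measurable_int iq.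
  move=> /(_ nu measurableT)[+ _]; case.
    under eq_integral do rewrite gee0_abs ?lee_fin//.
    rewrite -[LHS]fineK; last exact: integrable_fin_num iq.
    by have := dpsi0 (map_mx ratr q); rewrite /dual_radon /Rintegral => ->.
  move=> N [mN N0 NS]; exists N; split => // H HN; apply: NS => /= HT.
  by apply: HN => q' [<-]; have [] := HT Logic.I.
have := ae_foralln ae_rat; apply: filterS => H Hrat x.
(* A positive value at [x] would persist on a ball, which contains a rational point. *)
apply/eqP; rewrite eq_le psi_ge0 andbT leNgt; apply/negP => psix.
have := @aff_comp_continuous R n k psi H psi0.1 x.
move=> /cvgr_gt/(_ _ psix)/nbhs_ballP[e /= e0 eball].
have /choice[q qx] (j : 'I_n) : exists q : rat, ball (x 0%R j) e (ratr q : R).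
  have [r [xr [q _ qr]]] : ball (x 0%R j) e `&` range ratr !=set0.
    by apply: dense_rat; [exists (x 0%R j); exact: ballxx|exact: ball_open].
  by exists q; rewrite qr.
have /eball : ball x e (map_mx ratr (\row_j q j)).
  by split=> // i j; rewrite ord1 !mxE; exact: qx.
by rewrite /= (Hrat (pickle (\row_j q j))) ?ltxx// pickleK.
Qed.

End AgIntegral.

(** * Pairing with [f ^ (p - 1)] and Hoelder's inequality *)

Section Admissible.
Context {R : realType} {n k : nat}.
Local Notation G := (borel (grass R n k)).
Local Notation AG := (agrass R n k).

(** Young's inequality for the conjugate exponents [p] and [p / (p - 1)], multiplied by [p]. *)
Lemma powR_young (p a b : R) : 1 < p -> 0 <= a -> 0 <= b ->
  p * (b `^ (p - 1) * a) <= a `^ p + (p - 1) * b `^ p.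
Proof.
move=> p1 a0 b0; have p0 : 0 < p by exact: lt_trans p1.
have q0 : 0 < p - 1 by rewrite subr_gt0.
have := @conjugate_powR _ a (b `^ (p - 1)) p (p / (p - 1)) a0 (powR_ge0 _ _) p0
  (divr_gt0 p0 q0).
have -> : p^-1 + (p / (p - 1))^-1 = 1 by field; rewrite ?gt_eqF.
move=> /(_ erefl); rewrite -powRrM.
have -> : (p - 1) * (p / (p - 1)) = p by field; rewrite gt_eqF.
rewrite -(ler_pM2l p0); congr (_ <= _); first by ring.
by field; rewrite ?gt_eqF.
Qed.

Variables (nu : {measure set G -> \bar R}) (nu_fin : (nu setT < +oo)%E).
Variables (p : R) (p1 : 1 < p).
Variables (f : AG -> R) (mu : {finite_measure set (borel 'rV[R]_n) -> \bar R}).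
Hypotheses (f0 : C0 f) (f_ge0 : forall y, 0 <= f y).
Hypothesis fmu : is_radon nu mu (fun y => f y `^ (p - 1)).
Implicit Types psi phi w h g : AG -> R.

(** This is the pairing of [f ^ (p - 1)] with [psi], read on the side of [mu]: for [psi] in [C0] the
    integrand is bounded and continuous, so linearity in [psi] is available there. *)
Definition radon_pairing psi : R := \int[mu]_x dual_radon nu psi x.

Lemma radon_pairingE psi : C0 psi ->
  ag_integral nu (fun y => (f y `^ (p - 1) * psi y)%:E) = (radon_pairing psi)%:E.
Proof.
move=> psi0; rewrite (fmu psi0) /radon_pairing /Rintegral fineK//.
by apply: integrable_fin_num => //; exact: dual_radon_integrable.
Qed.

Lemma radon_pairing_lincomb psi phi (a b : R) : C0 psi -> C0 phi ->
  radon_pairing (fun y => a * psi y - b * phi y) =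
  a * radon_pairing psi - b * radon_pairing phi.
Proof.
move=> psi0 phi0; have ipsi := dual_radon_integrable nu_fin mu psi0.
have iphi := dual_radon_integrable nu_fin mu phi0.
rewrite /radon_pairing; under eq_Rintegral do rewrite dual_radon_lincomb//.
rewrite RintegralB ?RintegralZl//.
  exact: (integrableZl measurableT a ipsi).
exact: (integrableZl measurableT b iphi).
Qed.

Lemma le_radon_pairing psi phi (M : R) : C0 psi -> C0 phi ->
  (forall x, dual_radon nu psi x <= M * dual_radon nu phi x) ->
  radon_pairing psi <= M * radon_pairing phi.
Proof.
move=> psi0 phi0 le_dual; have ipsi := dual_radon_integrable nu_fin mu psi0.
have iphi := dual_radon_integrable nu_fin mu phi0.
rewrite /radon_pairing -RintegralZl//; apply: le_Rintegral => //.
exact: (integrableZl measurableT M iphi).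
Qed.

Lemma radon_pairing_self w (b : R) : Cb w -> (forall y, 0 <= w y) ->
  Lpnorm nu w p f = b%:E -> radon_pairing (fun y => f y * w y) = b `^ p.
Proof.
move=> wb w0 fb; have p0 : p != 0 by rewrite gt_eqF// (lt_trans _ p1).
have := Lpnorm_poweR nu f w0 p0; rewrite fb => bp.
have pairE := radon_pairingE (C0Mb f0 wb).
apply: EFin_inj; apply: etrans (esym pairE) _; apply: etrans _ (esym bp).
apply: eq_ag_integral => y; rewrite ger0_norm// mulrA.
by rewrite (mulrC (f y `^ _)) mulr_powRB1// (lt_trans _ p1).
Qed.

(* Hoelder's inequality for the pairing.  The inner integral of [h ^ p w] need
   not be known to be measurable in [H]: the pointwise Young inequality bounds
   [h ^ p w] below by [f ^ (p - 1) psi] for a signed [psi] in [C0], whose pairing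
   is computed on the side of [mu]. *)
Lemma radon_pairing_le w h (a b : R) : Cb w -> (forall y, 0 <= w y) ->
  (forall y, 0 <= h y) -> C0 (fun y => h y * w y) -> 0 < a -> 0 < b ->
  Lpnorm nu w p h = a%:E -> Lpnorm nu w p f = b%:E ->
  radon_pairing (fun y => h y * w y) <= a * b `^ (p - 1).
Proof.
move=> wb w0 h0 hw0 a0 b0 ha fb; have p0 : 0 < p by exact: lt_trans p1.
(* The factor [s] rescales [f] to the norm of [h], so that the integrated Young inequality becomes
   Hoelder's. *)
set c := radon_pairing _; pose s := a / b; have s0 : 0 < s by exact: divr_gt0.
have fw0 : C0 (fun y => f y * w y) by exact: C0Mb.
(* Young's inequality for [h y] and [s * f y], multiplied by [w y] and with its [f ^ p] term moved
   to the left, reads [f ^ (p - 1) * psi <= h ^ p * w]. *)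
pose psi y := (p * s `^ (p - 1)) * (h y * w y) - ((p - 1) * s `^ p) * (f y * w y).
have psi0 : C0 psi by exact: C0_lincomb.
have : radon_pairing psi <= a `^ p.
  have := Lpnorm_poweR nu h w0 (lt0r_neq0 p0); rewrite ha => ap.
  have pairE := radon_pairingE psi0.
  rewrite -lee_fin -[leLHS]pairE [leRHS]ap.
  apply: le_ag_integral => y; first by rewrite lee_fin mulr_ge0// powR_ge0.
  rewrite lee_fin ger0_norm//.
  have := powR_young p1 (h0 y) (mulr_ge0 (ltW s0) (f_ge0 y)).
  rewrite !(powRM _ (ltW s0) (f_ge0 y)).
  rewrite -lerBlDr => /(ler_wpM2r (w0 y)); apply: le_trans.
  rewrite /psi -(mulr_powRB1 (f_ge0 y) p0).
  by rewrite le_eqVlt; apply/orP; left; apply/eqP; ring.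
rewrite radon_pairing_lincomb// (radon_pairing_self wb w0 fb) -/c.
(* Since [s * b = a], the inequality becomes [p * s ^ (p - 1) * c <= p * a ^ p], where
   [a ^ p = s ^ (p - 1) * (a * b ^ (p - 1))]. *)
have sb : s * b = a by rewrite divfK ?gt_eqF.
rewrite lerBlDr -[X in _ <= _ + X]mulrA -(powRM _ (ltW s0) (ltW b0)) sb.
have -> : a `^ p + (p - 1) * a `^ p = p * a `^ p by ring.
have -> : a `^ p = s `^ (p - 1) * (a * b `^ (p - 1)).
  by rewrite -(mulr_powRB1 (ltW a0) p0) mulrCA -powRM ?ltW// sb.
by rewrite -mulrA ler_pM2l// ler_pM2l// powR_gt0.
Qed.

End Admissible.

(** * From an essential bound on the quotient to a bound at every point *)

Section Bound.
Context {R : realType} {n k : nat}.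
Local Notation G := (borel (grass R n k)).
Local Notation AG := (agrass R n k).
Variables (nu : {measure set G -> \bar R}) (nu_fin : (nu setT < +oo)%E).
Implicit Types psi phi : AG -> R.

Lemma dual_radon_le_of_quot psi phi (M : R) : C0 psi -> C0 phi ->
  (forall y, 0 <= psi y) -> (forall y, 0 <= phi y) ->
  {ae leb n, forall x : borel 'rV[R]_n,
    (`|quot (dual_radon nu psi x) (dual_radon nu phi x)| <= M%:E)%E} ->
  forall x, dual_radon nu psi x <= M * dual_radon nu phi x.
Proof.
move=> psi0 phi0 psi_ge0 phi_ge0 aeM.
apply: (@leb_ae_closed R n
  [set x | dual_radon nu psi x <= M * dual_radon nu phi x]).
  pose d := dual_radon nu (fun y => M * phi y - 1 * psi y).
  have -> : [set x | dual_radon nu psi x <= M * dual_radon nu phi x] =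
      d @^-1` [set t | 0 <= t].
    by apply/seteqP; split=> x /=; rewrite /d dual_radon_lincomb// mul1r subr_ge0.
  apply: closed_comp => [x _|]; last exact: closed_ge.
  by apply: dual_radon_continuous => //; exact: C0_lincomb.
apply: filterS aeM => x /=; rewrite /quot.
have a0 := dual_radon_ge0 nu x psi_ge0.
have := dual_radon_ge0 nu x phi_ge0; rewrite le_eqVlt => /predU1P[<-|b0].
(* Over a zero denominator only a zero numerator is possible, since otherwise [quot] is [+oo], above
   the finite [M]. *)
rewrite eqxx mulr0 /=; case: ifPn => [/eqP -> //|_].
  by rewrite leye_eq.
have ab0 := divr_ge0 a0 (ltW b0).
by rewrite gt_eqF//= lee_fin (ger0_norm ab0) ler_pdivrMr.
Qed.

End Bound.

(** * The estimate for a single admissible majorant *)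

Section AdmissibleBound.
Context {R : realType} {n k : nat}.
Local Notation G := (borel (grass R n k)).
Local Notation AG := (agrass R n k).
Variables (nu : {measure set G -> \bar R}) (nu_fin : (nu setT < +oo)%E).
Variables (p : R) (p1 : 1 < p) (w : AG -> R).
Hypotheses (wb : Cb w) (w0 : forall y, 0 <= w y).
Implicit Types f g h : AG -> R.

Let p0 : 0 < p. Proof. exact: lt_trans p1. Qed.

Lemma le_ag_powR f g : (forall y, 0 <= g y) -> (forall y, g y <= f y) ->
  (ag_integral nu (fun y => (`|g y| `^ p * w y)%:E) <=
   ag_integral nu (fun y => (`|f y| `^ p * w y)%:E))%E.
Proof.
move=> g0 gf; apply: le_ag_integral => y; first by rewrite lee_fin mulr_ge0// powR_ge0.
have fy0 : 0 <= f y by exact: le_trans (gf y).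
rewrite lee_fin ler_wpM2r// !ger0_norm//.
by apply: ge0_ler_powR => //; rewrite ?nnegrE// ltW.
Qed.

Lemma le_Lpnorm f g (b c : R) : (forall y, 0 <= g y) -> (forall y, g y <= f y) ->
  Lpnorm nu w p f = b%:E -> Lpnorm nu w p g = c%:E -> 0 <= b -> 0 < c -> c <= b.
Proof.
move=> g0 gf fb gc b0 c0; have := le_ag_powR g0 gf.
rewrite -!Lpnorm_poweR ?gt_eqF// fb gc !poweR_EFin lee_fin; apply: contraTT.
rewrite -!ltNge; apply: gt0_ltr_powR => //; rewrite nnegrE//; exact: ltW.
Qed.

Lemma admissible_bound f g h (a b c M : R) :
  admissible nu p f -> C0 g -> (forall y, 0 <= g y) -> (forall y, 0 <= h y) ->
  (forall y, g y <= f y) -> C0 (fun y => h y * w y) ->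
  0 < a -> 0 < b -> 0 < c -> 0 <= M ->
  Lpnorm nu w p h = a%:E -> Lpnorm nu w p f = b%:E -> Lpnorm nu w p g = c%:E ->
  (forall x, dual_radon nu (fun y => g y * w y) x <=
             M * dual_radon nu (fun y => h y * w y) x) ->
  c / a <= (b / c) `^ (p - 1) * M.
Proof.
move=> [f0 f_ge0 [mu fmu]] gC0 g0 h0 gf hw0 a0 b0 c0 M0 ha fb gc le_dual.
have gw0 : C0 (fun y => g y * w y) by exact: C0Mb.
have p10 : 0 < p - 1 by rewrite subr_gt0.
have le1 : c `^ p <= radon_pairing nu mu (fun y => g y * w y).
  have := Lpnorm_poweR nu g w0 (lt0r_neq0 p0); rewrite gc => cE.
  have pairE := radon_pairingE nu_fin fmu gw0.
  rewrite -lee_fin -[leRHS]pairE [leLHS]cE; apply: le_ag_integral => y.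
    by rewrite lee_fin !mulr_ge0// powR_ge0.
  rewrite lee_fin ger0_norm// mulrA ler_wpM2r// -(mulr_powRB1 (g0 y) p0) mulrC.
  rewrite ler_wpM2r//; apply: ge0_ler_powR; rewrite ?nnegrE//; exact: ltW.
have le2 := le_radon_pairing nu_fin mu gw0 hw0 le_dual.
have le3 := radon_pairing_le nu_fin p1 f0 f_ge0 fmu wb w0 h0 hw0 a0 b0 ha fb.
(* The chain gives [c ^ p <= M * (a * b ^ (p - 1))]; it remains to divide by [a * c ^ (p - 1)]. *)
have := le_trans le1 (le_trans le2 (ler_wpM2l M0 le3)).
rewrite -(mulr_powRB1 (ltW c0) p0) ler_pdivrMr//.
have cp : 0 < c `^ (p - 1) by rewrite powR_gt0.
have -> : (b / c) `^ (p - 1) = b `^ (p - 1) / c `^ (p - 1).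
  by rewrite powRM ?invr_ge0 ?(ltW b0) ?(ltW c0)// -powR_inv1 ?ltW// powRAC powR_inv1// ltW.
rewrite -ler_pdivlMr// => /le_trans; apply.
by rewrite le_eqVlt; apply/orP; left; apply/eqP; field; rewrite gt_eqF.
Qed.

End AdmissibleBound.

(** * Passage to the infimum, with the extreme values of the essential supremum *)

Theorem theorem5p2 (R : realType) (n k : nat) (hk : (0 < k < n)%N)
    (nu : {measure set (borel (grass R n k)) -> \bar R}) (hnu : is_haar nu)
    (p : R) (hp : 1 < p)
    (h w : agrass R n k -> R) (hCb : Cb h) (wCb : Cb w)
    (h_ge0 : forall Hz, 0 <= h Hz) (w_ge0 : forall Hz, 0 <= w Hz)
    (hwC0 : C0 (fun Hz => h Hz * w Hz))
    (hLp : in_Lp nu w p h) (wL1 : in_Lp nu (fun=> 1) 1 w)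
    (g : agrass R n k -> R) (g_ge0 : forall Hz, 0 <= g Hz)
    (gC0 : C0 g) (gLp : in_Lp nu w p g)
    (g_neq0 : Lpnorm nu w p g <> 0%E) (h_neq0 : Lpnorm nu w p h <> 0%E) :
  (Lpnorm nu w p g / Lpnorm nu w p h <=
   dist_admissible nu p w g `^ (p - 1) *
   'N[@leb R n]_+oo[(fun x : 'rV[R]_n =>
      quot (dual_radon nu (fun Hz => g Hz * w Hz)%R x)
           (dual_radon nu (fun Hz => h Hz * w Hz)%R x))])%E.
Proof.
have nu_fin : (nu setT < +oo)%E by rewrite hnu.2 ltry.
have p0 : 0 < p by exact: lt_trans hp.
have p10 : 0 < p - 1 by rewrite subr_gt0.
have [a a0 ha] := Lpnorm_fin_pos hLp h_neq0.
have [c c0 gc] := Lpnorm_fin_pos gLp g_neq0.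
have gw0 : C0 (fun y => g y * w y) by exact: C0Mb.
have gw_ge0 y : 0 <= g y * w y by exact: mulr_ge0.
have hw_ge0 y : 0 <= h y * w y by exact: mulr_ge0.
(* The norm of exponent [+oo] unfolds to an essential supremum only when the whole space has
   positive measure. *)
have lebT : (0 < leb n [set: 'rV[R]_n])%E by apply: leb_open_gt0; [exact: openT|exists 0].
have norm_ratio f : admissible nu p f -> in_Lp nu w p f -> (forall y, g y <= f y) ->
    exists b : R, [/\ 0 < b, c <= b, Lpnorm nu w p f = b%:E &
      (Lpnorm nu w p f / Lpnorm nu w p g = (b / c)%:E)%E].
  move=> fA fLp gf; have : (0 <= Lpnorm nu w p f)%E by exact: poweR_ge0.
  move: fLp; rewrite /in_Lp; case fb : (Lpnorm nu w p f) => [b| |]// _.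
  rewrite lee_fin => b0; have cb := le_Lpnorm hp w_ge0 g_ge0 gf fb gc b0 c0.
  by exists b; rewrite (lt_le_trans c0 cb) gc inver gt_eqF.
set D := dist_admissible nu p w g; set N := 'N[_]_+oo[_]%E.
have N0 : (0 <= N)%E by exact: Lnorm_ge0.
have aeN : {ae leb n, forall x : borel 'rV[R]_n,
    (`|quot (dual_radon nu (fun y => g y * w y)%R x)
            (dual_radon nu (fun y => h y * w y)%R x)| <= N)%E}.
  by rewrite /N unlock lebT; exact: ess_sup_ge.
have D1 : (1 <= D)%E.
  apply: le_ereal_inf_tmp => _ [f [fA fLp gf] <-].
  have [b [b0 cb fb ->]] := norm_ratio f fA fLp gf.
  by rewrite lee_fin ler_pdivlMr// mul1r.
have D0 : (0 < D `^ (p - 1))%E.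
  by apply: poweR_gt0; apply: lt_le_trans D1; rewrite lte_fin.
clearbody N; rewrite ha gc inver gt_eqF// -EFinM.
case: N N0 aeN => [M| |]// M0 aeM; last by rewrite gt0_muley// leey.
rewrite lee_fin in M0.
have le_dual := dual_radon_le_of_quot nu_fin gw0 hwC0 gw_ge0 hw_ge0 aeM.
have M_gt0 : 0 < M.
  rewrite lt_neqAle M0 andbT; apply/eqP => M00; apply: g_neq0.
  have dual0 x : dual_radon nu (fun y => g y * w y) x = 0.
    apply/eqP; rewrite eq_le dual_radon_ge0// andbT.
    by have := le_dual x; rewrite -M00 mul0r.
  have [S [mS S0 NS]] := ae_dual_radon0 nu_fin gw0 gw_ge0 dual0.
  rewrite /Lpnorm [ag_integral _ _](_ : _ = 0%E) ?poweR0r ?invr_eq0 ?gt_eqF//.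
  apply: (integral0_nomeas mS S0) => H.
    by apply: integral_ge0 => z _; rewrite lee_fin mulr_ge0// powR_ge0.
  move=> nSH; apply: integral0_eq => z _; congr EFin.
  (* Off the null set [S], either [g] or [w] vanishes at [y], and each kills [|g| ^ p * w]. *)
  set y := aff _ _; have gwy : g y * w y = 0.
    exact: (contrapT (contra_not (@NS H) nSH)).
  have /eqP := gwy; rewrite mulf_eq0 => /orP[/eqP ->|/eqP ->]; last by rewrite mulr0.
  by rewrite normr0 powR0 ?mul0r// gt_eqF.
(* The number [t] solves [t ^ (p - 1) * M = c / a]. Each competitor has ratio at least [t], a bound
   independent of [f], which therefore passes to the infimum, also when there is no competitor. *)
pose t := (c / a / M) `^ (p - 1)^-1.
have tD : (t%:E <= D)%E.
  apply: le_ereal_inf_tmp => _ [f [fA fLp gf] <-].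
  have [b [b0 cb fb ->]] := norm_ratio f fA fLp gf.
  have := admissible_bound nu_fin hp wCb w_ge0 fA gC0 g_ge0 h_ge0 gf hwC0 a0 b0 c0
    M0 ha fb gc le_dual.
  rewrite -ler_pdivrMr// lee_fin => cab.
  have bc0 : 0 <= b / c by rewrite divr_ge0 ?ltW.
  have -> : b / c = ((b / c) `^ (p - 1)) `^ (p - 1)^-1.
    by rewrite -powRrM divff ?gt_eqF// powRr1.
  apply: ge0_ler_powR => //; first by rewrite invr_ge0 ltW.
  - by rewrite nnegrE !divr_ge0 ?ltW.
  - by rewrite nnegrE powR_ge0.
have tE : t `^ (p - 1) = c / a / M.
  by rewrite /t -powRrM mulVf ?gt_eqF// powRr1// !divr_ge0 ?ltW.
have : ((c / a / M)%:E <= D `^ (p - 1))%E.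
  rewrite -tE -poweR_EFin; apply: gt0_ler_poweR => //; first exact: ltW.
    by rewrite in_itv/= leey andbT lee_fin powR_ge0.
  by rewrite in_itv/= leey andbT (le_trans _ D1)// lee_fin.
move=> /(lee_wpmul2r (x := M%:E)); rewrite lee_fin => /(_ M0).
by rewrite -EFinM divfK ?gt_eqF.
Qed.
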